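(* Let $X$ be a real vector space, let $C\subseteq X$ be a nonempty convex set and let $x\in C$. Then \[ F_{\min}(x,C) = C\cap \bigl(L + x\bigr), \] where $L$ is the lineality space of the convex cone $\operatorname{cone}(C-x)$, and $F_{\min}(x,C)$ is the minimal face of $C$ containing $x$.
   Context: For $y,z\in X$, the open segment is $(y,z)=\{ty+(1-t)z \mid t\in(0,1)\}$; the degenerate case $(y,y)=\{y\}$ is allowed. A face of a convex set $C$ is a convex subset $F\subseteq C$ (possibly empty or equal to $C$) such that for every $x\in F$ and all $y,z\in C$ with $x\in(y,z)$ we have $y,z\in F$. For $x\in C$, $F_{\min}(x,C)$ denotes the intersection of all faces of $C$ that contain $x$ (it is itself a face). For $S\subseteq X$, $\operatorname{cone} S$ is the set of all finite nonnegative linear combinations of points of $S$; for convex $S$, $\operatorname{cone} S=\{\alpha s \mid s\in S,\ \alpha\ge 0\}$. The lineality space of a nonempty convex cone $K$ is the largest linear subspace contained in $K$. *)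

(* Defs.v *)
From HB Require Import structures.
From mathcomp Require Import all_boot all_order all_algebra.
From mathcomp Require Import all_classical all_reals.
From mathcomp Require Import interval_inference convex.

Set Implicit Arguments.
Unset Strict Implicit.
Unset Printing Implicit Defensive.

Import Order.TTheory GRing.Theory Num.Theory.

Local Open Scope classical_set_scope.
Local Open Scope ring_scope.

Section defs.
Context {R : realType} {X : lmodType R}.
Implicit Types (C F K L S : set X) (x y z : X).

Definition open_segment y z : set X :=
  [set t *: y + (1 - t) *: z | t in `]0, 1[%classic].

Definition is_face C F : Prop :=
  [/\ convex_set F, F `<=` C &
      forall x y z, F x -> C y -> C z -> open_segment y z x -> F y /\ F z].

Definition F_min x C : set X := \bigcap_(F in [set F | is_face C F /\ F x]) F.

Definition cone S : set X :=
  [set v | exists (n : nat) (a : 'I_n -> R) (s : 'I_n -> X),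
     [/\ forall i, 0 <= a i, forall i, S (s i) & v = \sum_i a i *: s i]].

Definition is_subspace L : Prop := submod_closed [in L].

Definition is_lineality_space K L : Prop :=
  [/\ is_subspace L, L `<=` K &
      forall M : set X, is_subspace M -> M `<=` K -> M `<=` L].

(* A definite description: [lineality_spaceP] below shows that the described
   set exists whenever K is a nonempty convex cone. *)
Definition lineality_space K : set X := xget set0 (is_lineality_space K).

Definition is_convex_cone K : Prop :=
  convex_set K /\ forall (a : R) v, 0 <= a -> K v -> K (a *: v).

Lemma is_convex_coneD K u v : is_convex_cone K -> K u -> K v -> K (u + v).
Proof.
move=> [Kconv Kscale] Ku Kv.
have h01 : (0 <= 2^-1 :> R) && (2^-1 <= 1 :> R).
  by rewrite invr_ge0 ler0n invf_le1 ?ltr0n// ler1n.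
have p : exists p : {i01 R}, p%:num = 2^-1.
  by case/andP: h01 => h0 h1; exists (Itv01 h0 h1).
case: p => p hp.
have /set_mem /(Kscale 2 _ (ler0n _ _)) := Kconv u v p (mem_set Ku) (mem_set Kv).
rewrite /conv/= hp.
rewrite scalerDr !scalerA mulrBr mulr1 mulfV ?pnatr_eq0//.
by rewrite -addrA subrr addr0 !scale1r.
Qed.

Lemma lineality_spaceP K : K !=set0 -> is_convex_cone K ->
  is_lineality_space K (lineality_space K).
Proof.
move=> [k Kk] Kcone; rewrite /lineality_space.
suff : is_lineality_space K [set v | K v /\ K (- v)].
  by move=> h; exact: (xgetPex set0 (ex_intro _ _ h)).
have [_ Kscale] := Kcone.
split; last first.
- move=> M Msub MK v Mv; split; first exact: MK.
  apply: MK; apply: set_mem; rewrite -[- v]addr0 -scaleN1r.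
  by apply: Msub.2; [exact: mem_set|exact: Msub.1].
- by move=> v [].
split.
  apply/mem_set; rewrite /= oppr0.
  by split; rewrite -(scale0r k); exact: Kscale.
move=> a u v /set_mem[Ku KNu] /set_mem[Kv KNv]; apply/mem_set; rewrite /= opprD.
have [a0|a0] := leP 0 a.
  by split; apply: is_convex_coneD => //; rewrite -?scalerN; exact: Kscale.
split; apply: is_convex_coneD => //; last first.
  by rewrite -scaleNr; apply: Kscale => //; rewrite oppr_ge0 ltW.
by rewrite -[a *: u]opprK -scaleNr -scalerN; apply: Kscale => //; rewrite oppr_ge0 ltW.
Qed.

Lemma lineality_space_unique K L : is_lineality_space K L ->
  lineality_space K = L.
Proof.
move=> KL; have [s1 i1 m1] := KL.
have [s2 i2 m2] : is_lineality_space K (lineality_space K).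
  by rewrite /lineality_space; exact: (xgetPex set0 (ex_intro _ _ KL)).
by apply/seteqP; split; [exact: m1|exact: m2].
Qed.

Lemma cone0 S : cone S 0.
Proof.
exists 0, (fun=> 0), (fun=> 0); split=> [[]//|[]//|].
by rewrite big_ord0.
Qed.

Lemma cone_is_convex_cone S : is_convex_cone (cone S).
Proof.
have scale (a : R) v : 0 <= a -> cone S v -> cone S (a *: v).
  move=> a0 [n [b [s [b0 Ss ->]]]]; exists n, (fun i => a * b i), s; split=> //.
    by move=> i; exact: mulr_ge0.
  by rewrite scaler_sumr; apply: eq_bigr => i _; rewrite scalerA.
split=> // u v p /set_mem Su /set_mem Sv; apply/mem_set; rewrite /conv/=.
change (cone S (p%:num *: (u : X) + (1 - p%:num) *: (v : X))).
have {Su}: cone S (p%:num *: (u : X)) by exact: scale.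
have {Sv}: cone S ((1 - p%:num) *: (v : X)).
  by apply: scale => //; rewrite subr_ge0.
move=> [m [b [t [b0 St ->]]]] [n [a [s [a0 Ss ->]]]].
exists (m + n)%N,
  (fun i : 'I_(m + n) => match fintype.split i with inl j => b j | inr j => a j end),
  (fun i : 'I_(m + n) => match fintype.split i with inl j => t j | inr j => s j end).
split; [by move=> i; case: fintype.split|by move=> i; case: fintype.split|].
rewrite addrC big_split_ord/=; congr (_ + _); apply: eq_bigr => i _.
  by rewrite (unsplitK (inl i : 'I_m + 'I_n)).
by rewrite (unsplitK (inr i : 'I_m + 'I_n)).
Qed.

End defs.

(* Main.v *)
(** Write K = cone (C - x).  Convexity of C makes the feasible directions at x,
    i.e. the v with x + t v in C for some t > 0, a convex cone, so that K is
    exactly this set.  Hence a point y of C lies in L + x iff the segment from y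
    to x can be prolonged inside C beyond x.  Every face containing x contains
    such a y, and since K is closed under sums the set of such y is itself a
    face. *)
Require Import Defs.
From mathcomp Require Import all_boot all_order all_algebra.
From mathcomp Require Import all_classical all_reals convex.
From mathcomp Require Import interval_inference ring.

Import Order.TTheory GRing.Theory Num.Theory.

Local Open Scope classical_set_scope.
Local Open Scope ring_scope.

Lemma convex_setP (R : realType) (X : lmodType R) (C : set X) :
  convex_set C <->
  forall (y z : X) (t : R), 0 <= t <= 1 -> C y -> C z ->
    C (t *: y + (1 - t) *: z).
Proof.
split=> [Cconv y z t /andP[t0 t1] Cy Cz|Cconv y z p /set_mem Cy /set_mem Cz].
  exact: (set_mem (Cconv y z (Itv01 t0 t1) (mem_set Cy) (mem_set Cz))).
by apply/mem_set; apply: Cconv => //; apply/andP; split.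
Qed.

(** A subspace is closed under negation, which gives one inclusion. For the other, if both [v] and
    [- v] lie in [K], scaling puts the whole line spanned by [v] in [K], and maximality applies to
    that line. *)
Lemma lineality_spaceE (R : realType) (X : lmodType R) (K : set X) :
  K !=set0 -> is_convex_cone K ->
  lineality_space K = [set v | K v /\ K (- v)].
Proof.
move=> K0 Kcone; have [Lsub LK Lmax] := lineality_spaceP K0 Kcone.
have Lscale (a : R) v : lineality_space K v -> lineality_space K (a *: v).
  move=> Lv; apply: set_mem; rewrite -[a *: v]addr0.
  by apply: Lsub.2; [exact: mem_set|exact: Lsub.1].
apply/seteqP; split=> [v Lv|v [Kv KNv]].
  by split; apply: LK => //; rewrite -scaleN1r; exact: Lscale.
apply: (Lmax [set w | exists a : R, w = a *: v]); last by exists 1; rewrite scale1r.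
  split; first by apply/mem_set; exists 0; rewrite scale0r.
  move=> a _ _ /set_mem[b ->] /set_mem[c ->]; apply/mem_set.
  by exists (a * b + c); rewrite scalerDl scalerA.
move=> _ [a ->]; have [a0|a0] := leP 0 a; first exact: Kcone.2.
by rewrite -[a *: v]opprK -scaleNr -scalerN; apply: Kcone.2; rewrite ?oppr_ge0 ?ltW.
Qed.

Lemma sub_cone (R : realType) (X : lmodType R) (S : set X) : S `<=` cone S.
Proof.
move=> v Sv; exists 1, (fun=> 1), (fun=> v); split=> //.
by rewrite big_ord1 scale1r.
Qed.

Lemma cone_subP (R : realType) (X : lmodType R) (C : set X) (x : X) :
  convex_set C -> C x -> forall v,
  cone [set c - x | c in C] v <-> exists2 t : R, 0 < t & C (x + t *: v).
Proof.
move=> Cconv Cx v; split=> [[n [a [s [a0 Ss ->]]]]|[t t0 Ct]]; last first.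
  rewrite -[v]scale1r -(mulVf (lt0r_neq0 t0)) -scalerA.
  apply: (cone_is_convex_cone _).2; first by rewrite invr_ge0 ltW.
  by apply: sub_cone; exists (x + t *: v) => //; rewrite addrC addKr.
(* Induction on the sum: it remains to treat zero, a sum of two feasible directions, and a single
   term [a i *: s i]. *)
apply: (big_ind (fun w => exists2 t : R, 0 < t & C (x + t *: w))).
- by exists 1; rewrite // scaler0 addr0.
- move=> v1 v2 [t t0 Ct] [r r0 Cr].
  have tr0 : 0 < t + r by rewrite addr_gt0.
  have trN0 := lt0r_neq0 tr0.
  (* The weight [r / (t + r)] balances the two steps: it makes the coefficients of [v1] and [v2]
     both equal to [r * t / (t + r)]. *)
  exists (r / (t + r) * t); first by rewrite !mulr_gt0 // invr_gt0.
  have -> : x + (r / (t + r) * t) *: (v1 + v2) =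
      (r / (t + r)) *: (x + t *: v1) + (1 - r / (t + r)) *: (x + r *: v2).
    rewrite !scalerDr !scalerA addrACA -scalerDl [X in X *: x]addrC subrK scale1r.
    by congr (_ + (_ *: _ + _ *: _)); field.
  apply: (convex_setP _ _ _).1 => //.
  by rewrite ler_pdivrMr // mul1r lerDr divr_ge0 ltW.
- move=> i _; have [c Cc <-] := Ss i; have := a0 i.
  rewrite le0r => /predU1P[->|ai0].
    by exists 1; rewrite // scale0r scaler0 addr0.
  exists (a i)^-1; first by rewrite invr_gt0.
  by rewrite scalerA mulVf ?gt_eqF // scale1r addrC subrK.
Qed.

(** For [y] in [C] the direction [y - x] is in the cone for free, so only its opposite needs to be
    checked. *)
Lemma mem_lineality_translateP (R : realType) (X : lmodType R) (C : set X)
    (x y : X) :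
  (C `&` [set l + x | l in lineality_space (cone [set c - x | c in C])]) y <->
  C y /\ cone [set c - x | c in C] (x - y).
Proof.
rewrite lineality_spaceE; [|by exists 0; exact: cone0|exact: cone_is_convex_cone].
split=> [[Cy [l [_ KNl] ly]]|[Cy Kxy]].
  by split=> //; rewrite -ly opprD addrCA subrr addr0.
split=> //; exists (y - x); last by rewrite subrK.
by split; [apply: sub_cone; exists y|rewrite opprB].
Qed.

Lemma is_face_lineality_translate (R : realType) (X : lmodType R) (C : set X) (x : X) :
  convex_set C ->
  is_face C (C `&` [set l + x | l in lineality_space (cone [set c - x | c in C])]).
Proof.
move=> Cconv; set K := cone [set c - x | c in C].
have KD := is_convex_coneD (cone_is_convex_cone [set c - x | c in C]).
have [_ KZ] := cone_is_convex_cone [set c - x | c in C].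
split; [|exact: subIsetl|].
- apply/convex_setP => y z t t01 /mem_lineality_translateP[Cy Ky].
  move=> /mem_lineality_translateP[Cz Kz]; apply/mem_lineality_translateP.
  split; first exact: (convex_setP _ _ _).1.
  have -> : x - (t *: y + (1 - t) *: z) = t *: (x - y) + (1 - t) *: (x - z).
    by rewrite !scalerBr addrACA -scalerDl [X in X *: x]addrC subrK scale1r opprD addrC.
  by case/andP: t01 => t0 t1; apply: KD; apply: (KZ); rewrite ?subr_ge0.
(* With [w] the point of the segment, [t *: (x - y)] is [(x - w) + (1 - t) *: (z - x)], a sum of two
   elements of [K]. *)
have half (y z : X) (t : R) : 0 < t < 1 -> C z ->
    K (x - (t *: y + (1 - t) *: z)) -> K (x - y).
  move=> /andP[t0 t1] Cz Kw.
  have -> : x - y =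
      t^-1 *: (x - (t *: y + (1 - t) *: z) + (1 - t) *: (z - x)).
    apply: (scalerI (lt0r_neq0 t0)); rewrite scalerA mulfV ?gt_eqF // scale1r.
    rewrite !scalerBr opprD !addrA subrK addrAC; congr (_ - _).
    by rewrite scalerBl scale1r subKr.
  apply: (KZ); first by rewrite invr_ge0 ltW.
  apply: (KD) => //; apply: (KZ); first by rewrite subr_ge0 ltW.
  by apply: sub_cone; exists z.
move=> w y z /mem_lineality_translateP[_ Kw] Cy Cz [t].
rewrite /= in_itv/= => t01 tw; rewrite -tw in Kw.
split; apply/mem_lineality_translateP; split=> //; first exact: half Kw.
(* The other endpoint follows by symmetry, exchanging [t] and [1 - t]. *)
apply: (half z y (1 - t)) => //; first by rewrite subr_gt0 gtrBl andbC.
by rewrite subKr [X in x - X]addrC.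
Qed.

Theorem proposition2p4 (R : realType) (X : lmodType R) (C : set X) (x : X)
    (C_nonempty : C !=set0) (C_convex : convex_set C) (Cx : C x) :
  F_min x C =
  C `&` [set l + x | l in lineality_space (cone [set c - x | c in C])].
Proof.
apply/seteqP; split=> [y|y /mem_lineality_translateP[Cy]].
  apply; split; first exact: is_face_lineality_translate.
  by apply/mem_lineality_translateP; rewrite subrr; split=> //; exact: cone0.
move=> /(cone_subP _ _ _ _ C_convex Cx)[t t0 Cu] G [[_ _ Gface] Gx].
have t1 : 0 < 1 + t by rewrite addr_gt0.
have [] // := Gface x y (x + t *: (x - y)) Gx Cy Cu.
(* The weight [s] on [y] must cancel the [y] part of [x + t *: (x - y)]: solving [s = (1 - s) * t]
   gives this value. *)
exists (t / (1 + t)).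
  by rewrite /= in_itv/= divr_gt0 //= ltr_pdivrMr // mul1r ltrDr ltr01.
have -> : 1 - t / (1 + t) = (1 + t)^-1 by field; rewrite gt_eqF.
apply/esym/(scalerI (lt0r_neq0 t1)); rewrite scalerDl scalerDr !scalerA mulrCA.
rewrite !mulfV ?gt_eqF // mulr1 !scale1r scalerBr addrCA.
by rewrite [X in _ = _ + X]addrC subrK.
Qed.
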